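(* Let $\mathbb{K}$ be a field, let $n\geq 1$ and $p\geq 2$ be integers, and let $\mathcal{S}$ be a linear subspace of $\mathrm{M}_{n,p}(\mathbb{K})$ with $\operatorname{codim}_{\mathrm{M}_{n,p}(\mathbb{K})}\mathcal{S}\leq d_n(\mathbb{K})$. Then every range-compatible linear map $F:\mathcal{S}\to\mathbb{K}^n$ is local, i.e. there exists $X\in\mathbb{K}^p$ such that $F(M)=MX$ for all $M\in\mathcal{S}$.
   Context: $\mathrm{M}_{n,p}(\mathbb{K})$ denotes the space of $n\times p$ matrices over the field $\mathbb{K}$. We set $d_n(\mathbb{K}):=2n-3$ if $\mathbb{K}$ has more than $2$ elements, and $d_n(\mathbb{K}):=2n-4$ if $\mathbb{K}$ has exactly $2$ elements. For a subset $\mathcal{S}$ of $\mathrm{M}_{n,p}(\mathbb{K})$, a map $F:\mathcal{S}\to\mathbb{K}^n$ is range-compatible when $F(M)\in\operatorname{im}M$ (the column space of $M$) for all $M\in\mathcal{S}$; it is local when there is $X\in\mathbb{K}^p$ with $F(M)=MX$ for all $M\in\mathcal{S}$. *)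

(* Defs.v *)
From HB Require Import structures.
From mathcomp Require Import all_boot all_order all_algebra.
From Stdlib Require Import ClassicalEpsilon.
Set Implicit Arguments. Unset Strict Implicit. Unset Printing Implicit Defensive.
Import Order.TTheory GRing.Theory Num.Theory.
Local Open Scope ring_scope.

Definition more_than_two_elements (K : fieldType) : Prop :=
  exists x : K, x != 0 /\ x != 1.

(* d_n(K) = 2n-3 if #K > 2, 2n-4 if #K = 2 (as an integer, may be negative). *)
Definition d_n (K : fieldType) (n : nat) : int :=
  if excluded_middle_informative (more_than_two_elements K)
  then (2 * n)%:Z - 3 else (2 * n)%:Z - 4.

Definition codim (K : fieldType) (n p : nat) (S : {vspace 'M[K]_(n, p)}) : int :=
  (\dim (fullv : {vspace 'M[K]_(n, p)}))%:Z - (\dim S)%:Z.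

Definition range_compatible (K : fieldType) (n p : nat) (S : {vspace 'M[K]_(n, p)})
  (F : subvs_of S -> 'cV[K]_n) : Prop :=
  forall M : subvs_of S, exists Y : 'cV[K]_p, F M = vsval M *m Y.

Definition local (K : fieldType) (n p : nat) (S : {vspace 'M[K]_(n, p)})
  (F : subvs_of S -> 'cV[K]_n) : Prop :=
  exists X : 'cV[K]_p, forall M : subvs_of S, F M = vsval M *m X.

(* Main.v *)
Require Import Defs.
From HB Require Import structures.
From mathcomp Require Import all_boot all_order all_algebra.
From mathcomp Require Import ring zify.
From Stdlib Require Import Classical ClassicalEpsilon.
Import Order.TTheory GRing.Theory Num.Theory.
Local Open Scope ring_scope.
Set Implicit Arguments.
Unset Strict Implicit.
Unset Printing Implicit Defensive.

(* Dualize.  A linear [F] is range-compatible iff for every column [z] there is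
   a row [X z] with [z^T F(M) = z^T M (X z)^T] for all [M] in [S]; with [T] the
   orthogonal of [S], this says that [z |-> z X(z)] is linear modulo [T], and [F]
   is local iff [X] can be taken constant modulo [T].  Induct on [n]: for a row
   [y <> 0], restricting [z] to [ker y] replaces [T] by its matrices killed by
   [y], whose dimension is [dim T - dim (y T)], while the bound drops by 2.  So
   [X] is constant on [ker y] as soon as [dim (y T) >= 2]; call such [y] good.
   If all matrices of [T] have their rows in one line, a direct argument works.
   Otherwise there are two independent good [y1], [y2], with constants [x1], [x2];
   if no good [y3] lay outside [<y1, y2>], all rows of [T] would be multiples of
   [x2 - x1].  Finally, three independent good rows whose constants do not agree
   force [dim T >= 2n - 2].  The base case [n = 2] is the only place where the
   size of the field matters. *)

(** * Dual columns and independence of two rows *)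

Lemma exists_dual (K : fieldType) (k n : nat) (Y : 'M[K]_(k, n)) (y : 'rV_n) :
  ~~ (y <= Y)%MS -> exists z : 'cV_n, Y *m z = 0 /\ y *m z = 1%:M.
Proof.
rewrite submxE => /rV0Pn[j]; set c := _ 0 j => c_neq0.
exists (c^-1 *: col j (cokermx Y)); split.
  by rewrite colE -scalemxAr mulmxA mulmx_coker mul0mx scaler0.
rewrite colE -scalemxAr mulmxA -colE; apply/matrixP => i l.
by rewrite !ord1 mxE [X in _ * X]mxE -/c mulVf // mxE.
Qed.

Lemma row_free_col2 (K : fieldType) (n : nat) (a b : 'rV[K]_n) :
  a != 0 -> ~~ (b <= a)%MS -> row_free (col_mx a b).
Proof.
move=> a0 ba; apply: inj_row_free => v.
rewrite -[v]hsubmxK mul_row_col.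
rewrite [lsubmx v]mx11_scalar [rsubmx v]mx11_scalar !mul_scalar_mx.
set s := _ 0 0; set t := _ 0 0 => /eqP; rewrite addr_eq0 => /eqP e.
have t0 : t = 0.
  apply/eqP/negPn/negP => t0; case/negP: ba.
  have -> : b = - (t^-1 * s) *: a.
    by rewrite scaleNr -scalerA e scalerN opprK scalerA mulVf ?scale1r.
  exact: scalemx_sub.
move/eqP: e; rewrite t0 scale0r oppr0 scaler_eq0 (negPf a0) orbF => /eqP ->.
by rewrite !raddf0 row_mx0.
Qed.

Lemma not_row_free_col2 (K : fieldType) (n : nat) (a b : 'rV[K]_n) :
  ~~ row_free (col_mx a b) -> a != 0 -> exists s, b = s *: a.
Proof.
move=> h a0; apply/sub_rVP/negPn/negP => /(row_free_col2 a0).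
by rewrite (negPf h).
Qed.

(** * Families of rows modulo a matrix space, and gluing over kernels *)

(** [X] is only a choice of representatives: linearity is asked of the products [z *m X z] modulo
    [T], not of [X]. *)
Definition linear_mod (K : fieldType) (n p : nat) (T : {vspace 'M[K]_(n, p)})
  (X : 'cV[K]_n -> 'rV[K]_p) : Prop :=
  forall a z w,
    (a *: z + w) *m X (a *: z + w) - (a *: (z *m X z) + w *m X w) \in T.

Definition const_mod (K : fieldType) (n p : nat) (T : {vspace 'M[K]_(n, p)})
  (X : 'cV[K]_n -> 'rV[K]_p) : Prop :=
  exists x, forall z, z *m (X z - x) \in T.

Definition const_mod_on (K : fieldType) (n p : nat) (T : {vspace 'M[K]_(n, p)})
  (X : 'cV[K]_n -> 'rV[K]_p) (y : 'rV[K]_n) (x : 'rV[K]_p) : Prop :=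
  forall z, y *m z = 0 -> z *m (X z - x) \in T.

Lemma const_mod_comb (K : fieldType) (n p : nat) (T : {vspace 'M[K]_(n, p)})
  (X : 'cV[K]_n -> 'rV[K]_p) (x : 'rV[K]_p) (a : K) (z w : 'cV[K]_n) :
  linear_mod T X -> z *m (X z - x) \in T -> w *m (X w - x) \in T ->
  (a *: z + w) *m (X (a *: z + w) - x) \in T.
Proof.
move=> lin hz hw.
have -> : (a *: z + w) *m (X (a *: z + w) - x) =
  ((a *: z + w) *m X (a *: z + w) - (a *: (z *m X z) + w *m X w))
  + (a *: (z *m (X z - x)) + w *m (X w - x)).
  rewrite mulmxBr -addrA; congr (_ + _).
  rewrite !mulmxBr scalerBr mulmxDl -scalemxAl.
  by rewrite [a *: _ - _ + _]addrACA addKr opprD.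
by rewrite memvD ?lin // memvD // memvZ.
Qed.

(** The two kernels span everything: each column is a multiple of some [u] in the kernel of [y] plus
    a column killed by [y']. *)
Lemma const_mod_glue (K : fieldType) (n p : nat) (T : {vspace 'M[K]_(n, p)})
  (X : 'cV[K]_n -> 'rV[K]_p) (x : 'rV[K]_p) (y y' : 'rV[K]_n) :
  linear_mod T X -> ~~ (y' <= y)%MS ->
  const_mod_on T X y x -> const_mod_on T X y' x -> const_mod T X.
Proof.
move=> lin /exists_dual[u [yu y'u]] hy hy'; exists x => z.
have -> : z = (y' *m z) 0 0 *: u + (z - (y' *m z) 0 0 *: u) by rewrite addrC subrK.
apply: const_mod_comb => //; first exact: hy.
apply: hy'; rewrite mulmxBr -scalemxAr y'u scalemx1 -mx11_scalar.
exact: subrr.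
Qed.

(** * Scalar multipliers, and the case where all rows of [T] lie in one line *)

(** An operator with every vector an eigenvector is a homothety; here on the quotient by [W], with
    eigenvalue [f z] at [z]. *)
Lemma linear_mod_scalar (K : fieldType) (n : nat) (W : {vspace 'cV[K]_n})
  (f : 'cV[K]_n -> K) :
  (forall a z w, f (a *: z + w) *: (a *: z + w) - (a *: (f z *: z) + f w *: w) \in W) ->
  exists s, forall z, (f z - s) *: z \in W.
Proof.
move=> lin.
case: (boolP (fullv <= W)%VS) => [WT | /subvPn[u _ uW]].
  by exists 0 => z; rewrite (subvP WT) ?memvf.
have fW w : w \in W -> f w *: w \in W by move=> /memvZ.
exists (f u) => z.
case: (boolP (z \in <[u]> + W)%VS) => [/memv_addP[_ /vlineP[a ->] [w wW ->]] | zuW].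
  have -> : (f (a *: u + w) - f u) *: (a *: u + w) =
    (f (a *: u + w) *: (a *: u + w) - (a *: (f u *: u) + f w *: w))
    + (f w - f u) *: w.
    by apply/colP => i; rewrite !mxE; ring.
  by rewrite memvD ?lin // memvZ.
(* Now [z] and [u] are independent modulo [W], so [f (z + u)] must equal both [f z] and [f u]. *)
have := lin 1 z u; rewrite !scale1r.
set g := f _ => h.
have hz : (g - f z) *: z + (g - f u) *: u \in W.
  by move: h; rewrite scalerDr !scalerBl opprD addrACA.
have gz : g = f z.
  apply/eqP; rewrite -subr_eq0; apply/negPn/negP => gz; case/negP: zuW.
  apply/memv_addP; exists (- ((g - f z)^-1 * (g - f u)) *: u).
    exact/memvZ/memv_line.
  exists ((g - f z)^-1 *: ((g - f z) *: z + (g - f u) *: u)); first exact: memvZ.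
  by rewrite scalerDr !scalerA mulVf // scale1r scaleNr addrCA addNr addr0.
move: hz; rewrite gz subrr scale0r add0r.
case: (eqVneq (f z - f u) 0) => [-> | fzu]; first by rewrite !scale0r mem0v.
by move/(memvZ (f z - f u)^-1); rewrite scalerA mulVf // scale1r (negPf uW).
Qed.

Lemma mul_col_rowE (K : fieldType) (n p : nat) (z : 'cV[K]_n) (v : 'rV[K]_p) i j :
  (z *m v) i j = z i 0 * v 0 j.
Proof. by rewrite mxE big_ord1. Qed.

Lemma linear_mod0_const (K : fieldType) (n p : nat) (X : 'cV[K]_n -> 'rV[K]_p) :
  (forall a z w, (a *: z + w) *m X (a *: z + w) = a *: (z *m X z) + w *m X w) ->
  exists x, forall z, z *m X z = z *m x.
Proof.
move=> lin.
have hs j : exists s, forall z, X z 0 j *: z == s *: z.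
  have [a z w|s hs] := @linear_mod_scalar _ _ 0%VS (fun z => X z 0 j); last first.
    by exists s => z; have := hs z; rewrite memv0 scalerBl subr_eq0.
  rewrite memv0 subr_eq0; apply/eqP/colP => i.
  have /matrixP/(_ i j) := lin a z w.
  by rewrite !(mul_col_rowE, mxE) => e; rewrite [LHS]mulrC e; ring.
have [s {}hs] := fin_all_exists hs.
exists (\row_j s j) => z; apply/matrixP => i j.
have /eqP/colP/(_ i) := hs j z.
by rewrite !(mul_col_rowE, mxE) => e; rewrite mulrC e mulrC.
Qed.

(** Multiplying by the cokernel of [x] kills [T], so [X z] is constant modulo [<x>] for nonzero [z].
    What remains is a multiplier [f z] of [x], constant by [linear_mod_scalar] with [W] the columns
    [z] such that [z *m x] is in [T]. *)
Lemma const_mod_rank1 (K : fieldType) (n p : nat) (T : {vspace 'M[K]_(n, p)})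
  (X : 'cV[K]_n -> 'rV[K]_p) (x : 'rV[K]_p) :
  linear_mod T X -> (forall m, m \in T -> (m <= x)%MS) -> const_mod T X.
Proof.
move=> lin Tx.
have [Q subQ] : exists Q : 'M_p, forall k (m : 'M_(k, p)), (m <= x)%MS = (m *m Q == 0).
  by exists (cokermx x) => k m; exact: submxE.
have [|r hr] := @linear_mod0_const _ _ _ (fun z => X z *m Q).
  move=> a z w; apply/eqP; rewrite -subr_eq0 !mulmxA scalemxAl -mulmxDl -mulmxBl.
  by rewrite -subQ Tx // lin.
have [x0 hx0] : exists x0, forall z, z != 0 -> (X z - x0 <= x)%MS.
  clear T lin Tx.
  case: n X hr => [|n'] X hr; first by exists 0 => z; rewrite [z]flatmx0 eqxx.
  have hz z : z != 0 -> X z *m Q = r.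
    move=> /cV0Pn[i zi]; apply/rowP => j; apply: (mulfI zi).
    by have /matrixP/(_ i j) := hr z; rewrite !mul_col_rowE.
  exists (X (const_mx 1)) => z z0; rewrite subQ mulmxBl !hz ?subrr //.
  by apply/cV0Pn; exists 0; rewrite mxE oner_eq0.
have hs z : exists s, (z == 0) || (X z - x0 == s *: x).
  case: eqVneq => [_|/hx0/sub_rVP[s ->]]; first by exists 0.
  by exists s; exact: eqxx.
pose f z := xchoose (hs z).
have hf z : z *m (X z - x0) = (f z *: z) *m x.
  rewrite -scalemxAl scalemxAr; have /orP[/eqP->|/eqP->//] := xchooseP (hs z).
  by rewrite !mul0mx.
have := @linear_mod_scalar _ _ (linfun (mulmxr x) @^-1: T)%VS f.
case=> [a z w|s h].
  rewrite -memv_preim lfunE /= mulmxBl -hf [X in _ - X]mulmxDl -scalemxAl -!hf.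
  have -> : (a *: z + w) *m (X (a *: z + w) - x0)
     - (a *: (z *m (X z - x0)) + w *m (X w - x0)) =
     (a *: z + w) *m X (a *: z + w) - (a *: (z *m X z) + w *m X w).
    by apply/matrixP => i j; rewrite !(mul_col_rowE, mxE); ring.
  exact: lin.
exists (x0 + s *: x) => z; have := h z.
rewrite -memv_preim lfunE /= scalerBl mulmxBl -hf; congr (_ \in T).
by apply/matrixP => i j; rewrite !(mul_col_rowE, mxE); ring.
Qed.

(** * Existence of good rows *)

Lemma exists_not_submx (K : fieldType) (k n : nat) (Y : 'M[K]_(k, n)) :
  (k < n)%N -> exists y : 'rV_n, ~~ (y <= Y)%MS.
Proof.
move=> kn; have /row_subPn[i hi] : ~~ (1%:M <= Y)%MS.
  apply: contraTN kn => /mxrankS; rewrite mxrank1 -leqNgt => h.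
  exact: leq_trans h (rank_leq_row Y).
by exists (row i 1%:M).
Qed.

Lemma submxN (K : fieldType) (k n : nat) (Y : 'M[K]_(k, n)) (y : 'rV_n) :
  ((- y)%R <= Y)%MS = (y <= Y)%MS.
Proof.
apply/idP/idP => [|h]; last by rewrite -scaleN1r scalemx_sub.
by move/(scalemx_sub (-1)); rewrite scaleN1r opprK.
Qed.

Lemma exists_row_mul_neq0 (K : fieldType) (n p : nat) (m : 'M[K]_(n, p)) :
  m != 0 -> exists y : 'rV_n, y *m m != 0.
Proof.
rewrite -submx0 => /row_subPn[i]; rewrite submx0 rowE => h.
by exists (delta_mx 0 i).
Qed.

Lemma det_mx2 (R : comRingType) (A : 'M[R]_2) :
  \det A = A 0 0 * A 1 1 - A 0 1 * A 1 0.
Proof.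
rewrite (expand_det_row _ 0) !big_ord_recl big_ord0 addr0 /cofactor !det_mx11 !mxE.
rewrite /= expr0 expr1 mul1r mulN1r mulrN.
by congr (_ * A _ _ - A _ _ * A _ _); apply/val_inj.
Qed.

(* The compressions [D u] are linear in [u] with [D y = 1], so that singularity
   of [D u] and [D (u + y)] forces [\tr (D u) = - 1]; taking [u], [v], [u + v]
   outside [<y>] gives [1 = 0]. *)
Lemma dependent_extend (K : fieldType) (n p : nat) (T : {vspace 'M[K]_(n, p)})
  (y1 : 'rV[K]_n) :
  (2 < n)%N ->
  (forall (y : 'rV_n) (m m' : 'M_(n, p)), ~~ (y <= y1)%MS -> m \in T -> m' \in T ->
     ~~ row_free (col_mx (y *m m) (y *m m'))) ->
  forall (y : 'rV_n) (m m' : 'M_(n, p)), m \in T -> m' \in T ->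
     ~~ row_free (col_mx (y *m m) (y *m m')).
Proof.
move=> n3 dep y m m' mT m'T; apply/negP => free_y.
have [yy1|yy1] := boolP (y <= y1)%MS; last first.
  by have := dep y m m' yy1 mT m'T; rewrite free_y.
have y1y : (y1 <= y)%MS.
  have y_neq0 : y != 0.
    apply: contraTneq free_y => ->; rewrite !mul0mx col_mx0 /row_free mxrank0 //.
  move/sub_rVP: yy1 y_neq0 => [s ->]; rewrite scaler_eq0 negb_or => /andP[s0 _].
  by rewrite -[X in (X <= _)%MS]scale1r -(mulVf s0) -scalerA scalemx_sub.
have {}dep (u : 'rV_n) : ~~ (u <= y)%MS -> ~~ row_free (col_mx (u *m m) (u *m m')).
  by move=> uy; apply: dep => //; apply: contra uy => /submx_trans->.
have [C hC] := row_freeP free_y.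
pose D (u : 'rV_n) : 'M_(1 + 1) := col_mx (u *m m) (u *m m') *m C.
have DD (u v : 'rV_n) : D (u + v) = D u + D v.
  by rewrite /D -mulmxDl add_col_mx !mulmxDl.
have detD (u : 'rV_n) : ~~ (u <= y)%MS -> \det (D u) = 0.
  move=> /dep; apply: contraNeq => Du; apply/row_freeP; exists (C *m invmx (D u)).
  by rewrite mulmxA mulmxV // unitmxE unitfE.
have trD (u : 'rV_n) : ~~ (u <= y)%MS -> D u 0 0 + D u 1 1 = - 1.
  move=> uy; have uyy : ~~ ((u + y)%R <= y)%MS.
    by apply: contra uy => h; rewrite -(addrK y u) addmx_sub // submxN.
  have := detD _ uy; have := detD _ uyy.
  rewrite DD [D y]hC; move: (D u) => M; rewrite !det_mx2 !mxE /= !addr0 => e1 e2.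
  apply/eqP; rewrite -subr_eq0 opprK; apply/eqP.
  rewrite -[RHS](subr0 0) -{1}e1 -e2; ring.
have [u uy] := exists_not_submx y (ltn_trans (ltnSn 1) n3).
have [v vy] := exists_not_submx (col_mx y u) n3.
have vy' : ~~ (v <= y)%MS.
  by apply: contra vy => /submx_trans->//; rewrite -addsmxE addsmxSl.
have uvy : ~~ ((u + v)%R <= y)%MS.
  apply: contra vy => h; rewrite -(addKr u v) addrC addmx_sub //.
    by apply: (submx_trans h); rewrite -addsmxE addsmxSl.
  by rewrite submxN -addsmxE addsmxSr.
move: (trD _ uy) (trD _ vy') (trD _ uvy); rewrite DD; move: (D u) (D v) => M N hM hN.
rewrite !mxE addrACA hM hN => /eqP.
by rewrite -subr_eq0 opprK subrK oppr_eq0 oner_eq0.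
Qed.

Lemma scale_eq_indep (K : fieldType) (n : nat) (a b : 'rV[K]_n) (s t : K) :
  ~~ (b <= a)%MS -> s *: a = t *: b -> t = 0.
Proof.
move=> ba e; apply/eqP; apply: contraNT ba => t0.
by rewrite -[b]scale1r -(mulVf t0) -scalerA -e !scalemx_sub.
Qed.

(** Classical dichotomy: if every [y] sends [T] into a line, then either all rows of [T] lie in one
    line, which the second hypothesis excludes, or [T] itself is at most a line. *)
Lemma dependent_line (K : fieldType) (n p : nat) (T : {vspace 'M[K]_(n, p)}) :
  (forall (y : 'rV_n) (m m' : 'M_(n, p)), m \in T -> m' \in T ->
     ~~ row_free (col_mx (y *m m) (y *m m'))) ->
  (forall x : 'rV_p, exists2 m : 'M_(n, p), m \in T & ~~ (m <= x)%MS) ->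
  exists m (y y' : 'rV_n), [/\ m \in T, (T <= <[m]>)%VS, ~~ (y' <= y)%MS, y *m m != 0
                   & y' *m m != 0].
Proof.
move=> dep0 big.
have dep (u : 'rV_n) k k' : k \in T -> k' \in T -> u *m k != 0 ->
    exists s, u *m k' = s *: (u *m k).
  by move=> kT k'T; apply: not_row_free_col2; apply: dep0.
have [m mT] := big 0; rewrite eqmx0 submx0 => /exists_row_mul_neq0[y].
set x := y *m m => x0.
have [m' m'T /row_subPn[i]] := big x; rewrite rowE.
set y' := delta_mx 0 i; set x' := y' *m m' => x'x.
have x'0 : x' != 0 by apply: contraNneq x'x => ->; exact: sub0mx.
have [mu hmu] := dep _ _ _ m'T mT x'0.
(* If [u *m k] is nonzero, any [w] killing [k] sends [T] into [<u *m k>], as seen by comparing [u]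
   with [u + w]. Then [x] and [x'] would be collinear. *)
have key k : k \in T -> y *m k = 0 -> y' *m k = 0 -> k = 0.
  move=> kT yk y'k; apply/eqP/negPn/negP => /exists_row_mul_neq0[u uk].
  have on_line w l : l \in T -> w *m k = 0 -> exists s, w *m l = s *: (u *m k).
    move=> lT wk; have [s hs] := dep u k l kT lT uk.
    have [|r hr] := dep (u + w) k l kT lT; first by rewrite mulmxDl wk addr0.
    exists (r - s); move: hr; rewrite !mulmxDl wk addr0 hs scalerBl => <-.
    by rewrite addrC addKr.
  have [s hs] := on_line _ _ mT yk; have [r hr] := on_line _ _ m'T y'k.
  rewrite -/x in hs; rewrite -/x' in hr.
  have : r *: x = s *: x' by rewrite hs hr !scalerA mulrC.
  by move/(scale_eq_indep x'x) => s0; move: x0; rewrite hs s0 scale0r eqxx.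
(* [(y + y') *m k] is a multiple both of [x'] and of [x + mu *: x'], hence zero. *)
have key2 k : k \in T -> y *m k = 0 -> k = 0.
  move=> kT yk; apply: key => //; have [g hg] := dep _ _ _ m'T kT x'0.
  have hne : (y + y') *m m != 0.
    rewrite mulmxDl hmu; apply: contraNneq x0 => e.
    have : 1 *: x = (- mu) *: x'.
      by apply/eqP; rewrite scale1r scaleNr -addr_eq0 e.
    by move=> e1; rewrite -/x -[x]scale1r e1 (scale_eq_indep x'x e1) scale0r.
  have [s] := dep _ _ _ mT kT hne.
  rewrite !mulmxDl yk add0r hmu hg -/x -/x' scalerDr scalerA => e.
  have e1 : s *: x = (g - s * mu) *: x' by rewrite scalerBl e addrK.
  have g0 := scale_eq_indep x'x e1.
  move: e1; rewrite g0 scale0r => /eqP; rewrite scaler_eq0 (negPf x0) orbF => /eqP s0.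
  by move: g0; rewrite s0 mul0r subr0 => ->; rewrite scale0r.
have Tm k : k \in T -> exists s, k = s *: m.
  move=> kT; have [s hs] := dep _ _ _ mT kT x0; exists s.
  apply/eqP; rewrite -subr_eq0; apply/eqP/key2; first by rewrite memvB ?memvZ.
  by rewrite mulmxBr hs -scalemxAr subrr.
exists m, y, y'; split => //.
- by apply/subvP => k /Tm[s ->]; rewrite memvZ ?memv_line.
- have [s hs] := Tm _ m'T.
  apply: contra x'x => /sub_rVP[c hc]; rewrite /x' hc hs -scalemxAl -scalemxAr.
  by rewrite !scalemx_sub.
- have [s hs] := Tm _ m'T.
  by apply: contraNneq x'0 => e; rewrite /x' hs -scalemxAr e scaler0.
Qed.

(** Otherwise all good rows lie in some [<y1>], so by [dependent_extend] every row sends [T] into a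
    line; [dependent_line] then makes [T] a line and yields two independent rows not killing it. *)
Lemma two_good (K : fieldType) (n p : nat) (T : {vspace 'M[K]_(n, p)})
  (good : 'rV[K]_n -> Prop) :
  (2 < n)%N ->
  (forall (y : 'rV_n) (m m' : 'M_(n, p)), m \in T -> m' \in T ->
     row_free (col_mx (y *m m) (y *m m')) -> good y) ->
  (forall (y : 'rV_n) (m : 'M_(n, p)), m \in T -> (T <= <[m]>)%VS ->
     y *m m != 0 -> good y) ->
  (forall x : 'rV_p, exists2 m : 'M_(n, p), m \in T & ~~ (m <= x)%MS) ->
  exists y y' : 'rV_n, [/\ y != 0, ~~ (y' <= y)%MS, good y & good y'].
Proof.
move=> n3 good2 good1 big; apply: NNPP => no_pair.
(* The value [y1 = 0] covers the case where no nonzero row is good. *)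
have [y1 y1P] : exists y1 : 'rV_n, forall y, ~~ (y <= y1)%MS -> ~ good y.
  apply: NNPP => no_y1.
  have /not_all_ex_not[y hy] : ~ forall y, y != 0 -> ~ good y.
    by move=> h; apply: no_y1; exists 0 => y; rewrite eqmx0 submx0; exact: h.
  have [y0 gy] := imply_to_and _ _ hy.
  apply: no_y1; exists y => y' y'y gy'; apply: no_pair; exists y, y'.
  by split=> //; apply: NNPP.
have dep := @dependent_extend _ _ _ T y1 n3.
have {}dep (y : 'rV_n) (m m' : 'M_(n, p)) : m \in T -> m' \in T ->
     ~~ row_free (col_mx (y *m m) (y *m m')).
  apply: dep => {}y {}m {}m' yy1 mT m'T; apply/negP => /good2 gy.
  exact: (y1P _ yy1 (gy mT m'T)).
have [m [y [y' [mT Tm y'y ym y'm]]]] := dependent_line dep big.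
apply: no_pair; exists y, y'; split=> //; [|exact: good1 ym|exact: good1 y'm].
by apply: contraNneq ym => ->; rewrite mul0mx.
Qed.

(** The source of explicit elements of [T]: where both constants are valid, [T] absorbs their
    difference. *)
Lemma const_mod_on_diff (K : fieldType) (n p : nat) (T : {vspace 'M[K]_(n, p)})
  (X : 'cV[K]_n -> 'rV[K]_p) (y y' : 'rV[K]_n) (x x' : 'rV[K]_p) (z : 'cV[K]_n) :
  const_mod_on T X y x -> const_mod_on T X y' x' -> y *m z = 0 -> y' *m z = 0 ->
  z *m (x' - x) \in T.
Proof.
move=> hy hy' /hy h /hy' h'; have := memvB h h'; congr (_ \in T).
by apply/matrixP => i j; rewrite !(mul_col_rowE, mxE); ring.
Qed.

(** For [y] outside the span, take [z] killed by [y1] and [y2] with [y *m z = 1]. Then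
    [z *m (x2 - x1)] is in [T] and [y] sends it to [x2 - x1], so a [y] that is not good sends all of
    [T] into [<x2 - x1>]. *)
Lemma third_good (K : fieldType) (n p : nat) (T : {vspace 'M[K]_(n, p)})
  (X : 'cV[K]_n -> 'rV[K]_p) (y1 y2 : 'rV[K]_n) (x1 x2 : 'rV[K]_p) :
  (2 < n)%N ->
  (forall (y : 'rV_n) (m m' : 'M_(n, p)), m \in T -> m' \in T ->
     row_free (col_mx (y *m m) (y *m m')) -> exists x, const_mod_on T X y x) ->
  (forall x : 'rV_p, exists2 m : 'M_(n, p), m \in T & ~~ (m <= x)%MS) ->
  const_mod_on T X y1 x1 -> const_mod_on T X y2 x2 -> x2 != x1 ->
  exists (y3 : 'rV_n) x3, ~~ (y3 <= col_mx y1 y2)%MS /\ const_mod_on T X y3 x3.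
Proof.
move=> n3 good2 big h1 h2 x21; apply: NNPP => no_third.
have [m mT /row_subPn[i]] := big (x2 - x1); case/negP; rewrite rowE.
have out (y : 'rV_n) : ~~ (y <= col_mx y1 y2)%MS -> (y *m m <= x2 - x1)%MS.
  move=> yY; have [z [Yz yz]] := exists_dual yY.
  have [y1z y2z] : y1 *m z = 0 /\ y2 *m z = 0.
    by apply/eq_col_mx; rewrite col_mx0 -mul_col_mx.
  have xT := const_mod_on_diff h1 h2 y1z y2z.
  have yzx : y *m (z *m (x2 - x1)) = x2 - x1 by rewrite mulmxA yz mul1mx.
  apply/sub_rVP; rewrite -yzx; apply: not_row_free_col2; last first.
    by rewrite yzx subr_eq0.
  apply/negP => /(good2 _ _ _ xT mT)[x3 h3].
  by apply: no_third; exists y, x3.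
set y := delta_mx 0 i; case: (boolP (y <= col_mx y1 y2)%MS) => [yY|/out//].
(* A row inside the span is the difference of two rows outside it, [y + u] and [u]. *)
have [u uY] := exists_not_submx (col_mx y1 y2) n3.
rewrite -[y](addrK u) mulmxBl addmx_sub ?submxN ?out //.
apply: contra uY => h; rewrite -(addKr y u) addmx_sub ?submxN //.
Qed.

(** * Three good rows and the dimension count *)

Lemma exists_dual3 (K : fieldType) (n : nat) (y1 y2 y3 : 'rV[K]_n) :
  y1 != 0 -> ~~ (y2 <= y1)%MS -> ~~ (y3 <= col_mx y1 y2)%MS ->
  exists z1 z2 z3 : 'cV_n,
    [/\ [/\ y1 *m z1 = 1%:M, y1 *m z2 = 0 & y1 *m z3 = 0],
        [/\ y2 *m z1 = 0, y2 *m z2 = 1%:M & y2 *m z3 = 0]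
      & [/\ y3 *m z1 = 0, y3 *m z2 = 0 & y3 *m z3 = 1%:M]].
Proof.
move=> y10 /exists_dual[u2 [y1u2 y2u2]] /exists_dual[z3 [Yz3 y3z3]].
have [y1z3 y2z3] : y1 *m z3 = 0 /\ y2 *m z3 = 0.
  by apply/eq_col_mx; rewrite col_mx0 -mul_col_mx.
have [u1 [_ y1u1]] : exists u1 : 'cV_n, (0 : 'rV_n) *m u1 = 0 /\ y1 *m u1 = 1%:M.
  by apply: exists_dual; rewrite eqmx0 submx0.
pose z2 := u2 - z3 *m (y3 *m u2).
have [y1z2 y2z2 y3z2] : [/\ y1 *m z2 = 0, y2 *m z2 = 1%:M & y3 *m z2 = 0].
  by rewrite !mulmxBr !mulmxA y1z3 y2z3 y3z3 !mul0mx mul1mx y1u2 y2u2 !subr0 subrr.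
exists (u1 - z2 *m (y2 *m u1) - z3 *m (y3 *m u1)), z2, z3; split; split=> //;
  rewrite !mulmxBr !mulmxA ?y1z2 ?y2z2 ?y3z2 ?y1z3 ?y2z3 ?y3z3 !mul0mx ?mul1mx ?subr0 //.
- by rewrite subrr.
- by rewrite subrr.
Qed.

(** A nontrivial relation modulo [V] expresses one vector through the others, so capturing all three
    costs only two dimensions. *)
Lemma three_terms_span (K : fieldType) (vT : vectType K) (V : {vspace vT})
  (a b c : K) (u v w : vT) :
  a *: u + b *: v + c *: w \in V -> [|| a != 0, b != 0 | c != 0] ->
  exists2 V' : {vspace vT}, (V <= V')%VS /\ (\dim V' <= \dim V + 2)%N
    & [/\ u \in V', v \in V' & w \in V'].
Proof.
have dim2 (A B : vT) : (\dim (V + (<[A]> + <[B]>)) <= \dim V + 2)%N.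
  apply: leq_trans (dimv_add_leqif _ _).1 _; rewrite leq_add2l.
  by apply: leq_trans (dimv_add_leqif _ _).1 _; rewrite !dim_vline; do 2!case: eqP.
have memA (A B : vT) : A \in (V + (<[A]> + <[B]>))%VS.
  by rewrite (subvP (addvSr _ _)) // (subvP (addvSl _ _)) ?memv_line.
have memB (A B : vT) : B \in (V + (<[A]> + <[B]>))%VS.
  by rewrite (subvP (addvSr _ _)) // (subvP (addvSr _ _)) ?memv_line.
have memC (s r t : K) (A B C : vT) : s != 0 -> s *: A + r *: B + t *: C \in V ->
    A \in (V + (<[B]> + <[C]>))%VS.
  move=> s0 h; rewrite -[A]scale1r -(mulVf s0) -scalerA memvZ //.
  have -> : s *: A = (s *: A + r *: B + t *: C) - (r *: B + t *: C).
    by rewrite -[_ + t *: C]addrA addrK.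
  rewrite memvB ?(subvP (addvSl _ _) _ h) //.
  by rewrite memvD ?memvZ ?memA ?memB.
move=> h /or3P[a0|b0|c0].
- exists (V + (<[v]> + <[w]>))%VS; first by rewrite addvSl.
  by rewrite (memC _ _ _ _ _ _ a0 h).
- exists (V + (<[u]> + <[w]>))%VS; first by rewrite addvSl.
  by rewrite [a *: u + _]addrC in h; rewrite (memC _ _ _ _ _ _ b0 h).
- exists (V + (<[u]> + <[v]>))%VS; first by rewrite addvSl.
  by rewrite addrC addrA in h; rewrite (memC _ _ _ _ _ _ c0 h).
Qed.

(** If [x2 - x1] and [x3 - x1] are dependent, two constants can be made equal and glued. If not,
    sending them to [e1] and [e2] compresses [T] to a space [V] of matrices with two columns, which
    two further dimensions fill: [2n <= dim T + 2], a contradiction. *)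
Lemma const_mod_of_three (K : fieldType) (n p : nat) (T : {vspace 'M[K]_(n, p)})
  (X : 'cV[K]_n -> 'rV[K]_p) (y1 y2 y3 : 'rV[K]_n) (x1 x2 x3 : 'rV[K]_p) :
  linear_mod T X -> (\dim T + 3 <= 2 * n)%N ->
  y1 != 0 -> ~~ (y2 <= y1)%MS -> ~~ (y3 <= col_mx y1 y2)%MS ->
  const_mod_on T X y1 x1 -> const_mod_on T X y2 x2 -> const_mod_on T X y3 x3 ->
  const_mod T X.
Proof.
move=> lin dimT y10 y2y1 y3y h1 h2 h3.
have y3y1 : ~~ (y3 <= y1)%MS.
  by apply: contra y3y => /submx_trans->//; rewrite -addsmxE addsmxSl.
have [z1 [z2 [z3 [[y1z1 y1z2 y1z3] [y2z1 y2z2 y2z3] [y3z1 y3z2 y3z3]]]]] :=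
  exists_dual3 y10 y2y1 y3y.
pose x := x2 - x1; pose x' := x3 - x1.
have T12 (z : 'cV_n) : y1 *m z = 0 -> y2 *m z = 0 -> z *m x \in T.
  exact: (const_mod_on_diff h1 h2).
have T13 (z : 'cV_n) : y1 *m z = 0 -> y3 *m z = 0 -> z *m x' \in T.
  exact: (const_mod_on_diff h1 h3).
have T23 (z : 'cV_n) : y2 *m z = 0 -> y3 *m z = 0 -> z *m (x' - x) \in T.
  move=> y2z y3z; have -> : x' - x = x3 - x2 by rewrite /x' /x opprB addrA subrK.
  exact: (const_mod_on_diff h2 h3).
have [/eqP|x0] := boolP (x == 0).
  move/eqP; rewrite subr_eq0 => /eqP e; rewrite -e in h1.
  exact: (const_mod_glue lin y2y1 h1 h2).
have [free_x|/not_row_free_col2/(_ x0)[s hs]] := boolP (row_free (col_mx x x')); last first.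
  have [s0|s0] := eqVneq s 0.
    move/eqP: hs; rewrite s0 scale0r subr_eq0 => /eqP e; rewrite -e in h1.
    exact: (const_mod_glue lin y3y1 h1 h3).
  (* The kernel of [y1] is its intersection with that of [y2], plus [<z2>]: [T12] handles the
     former, and [T13] the latter because [x' = s *: x] with [s] nonzero. So [x2] can replace [x1]
     on it. *)
  have Tx (z : 'cV_n) : y1 *m z = 0 -> z *m x \in T.
    move=> y1z; have -> : z = (z - z2 *m (y2 *m z)) + z2 *m (y2 *m z) by rewrite subrK.
    rewrite mulmxDl memvD //.
      apply: T12; rewrite mulmxBr !mulmxA; first by rewrite y1z y1z2 !mul0mx subrr.
      by rewrite y2z2 mul1mx subrr.
    rewrite [y2 *m z]mx11_scalar mul_mx_scalar -scalemxAl memvZ //.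
    have := memvZ s^-1 (T13 _ y1z2 y3z2).
    by rewrite hs -scalemxAr scalerA mulVf // scale1r.
  have h12 : const_mod_on T X y1 x2.
    move=> z y1z; have := memvB (h1 z y1z) (Tx z y1z).
    by rewrite -mulmxBr /x opprB addrA subrK.
  exact: (const_mod_glue lin y2y1 h12 h2).
have [C hC] := row_freeP free_x; exfalso.
pose V := (linfun (mulmxr C) @: T)%VS.
have VT (m : 'M_(n, p)) : m \in T -> m *m C \in V.
  by move=> mT; have := memv_img (linfun (mulmxr C)) mT; rewrite lfunE.
have dimV : (\dim V <= \dim T)%N by rewrite -(limg_ker_dim (linfun (mulmxr C)) T) leq_addl.
pose e1 : 'rV[K]_(1 + 1) := row_mx 1%:M 0; pose e2 : 'rV[K]_(1 + 1) := row_mx 0 1%:M.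
have [xC x'C] : x *m C = e1 /\ x' *m C = e2.
  by apply/eq_col_mx; rewrite -mul_col_mx hC scalar_mx_block block_mxEv.
have V12 (z : 'cV_n) : y1 *m z = 0 -> y2 *m z = 0 -> z *m e1 \in V.
  by move=> a b; rewrite -xC mulmxA VT ?T12.
have V13 (z : 'cV_n) : y1 *m z = 0 -> y3 *m z = 0 -> z *m e2 \in V.
  by move=> a b; rewrite -x'C mulmxA VT ?T13.
have V23 (z : 'cV_n) : y2 *m z = 0 -> y3 *m z = 0 -> z *m (e2 - e1) \in V.
  by move=> a b; rewrite -x'C -xC -mulmxBl mulmxA VT ?T23.
(* [V] visibly contains a space of dimension [2n - 3]; since [u *m X u] has rank
   one, [uV] below puts one more independent vector in [V]. *)
pose u := z1 + z2 + z3.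
have uT : u *m (X u - x1) - z1 *m x \in T.
  have l1 := lin 1 z1 z2; have l2 := lin 1 (z1 + z2) z3.
  rewrite !scale1r in l1 l2.
  (* Modulo [T], [u *m X u] is [z1 *m x2 + z2 *m x1 + z3 *m x1]. *)
  have a1 := h2 _ y2z1; have a2 := h1 _ y1z2; have a3 := h1 _ y1z3.
  have := memvD (memvD l2 l1) (memvD a1 (memvD a2 a3)); congr (_ \in T).
  by apply/matrixP => i j; rewrite !(mul_col_rowE, mxE); ring.
pose al := ((X u - x1) *m C) 0 0; pose be := ((X u - x1) *m C) 0 1.
have rowE2 (r : 'rV[K]_(1 + 1)) : r = r 0 0 *: e1 + r 0 1 *: e2.
  rewrite /e1 /e2 !scale_row_mx !scaler0 add_row_mx add0r addr0 !scalemx1 -[LHS]hsubmxK.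
  congr row_mx; apply/matrixP => i j; rewrite !ord1 !mxE /= mulr1n;
    by congr (r _ _); apply/val_inj.
have uV : (al + be - 1) *: (z1 *m e1) + al *: (z2 *m e1) + be *: (z3 *m e2) \in V.
  (* Modulo [V], [z1 *m e2] equals [z1 *m e1], while [z2 *m e2] and [z3 *m e1] vanish. *)
  have := memvD (memvD (VT _ uT) (memvZ (- be) (V23 _ y2z1 y3z1)))
     (memvD (memvZ (- be) (V13 _ y1z2 y3z2)) (memvZ (- al) (V12 _ y1z3 y2z3))).
  rewrite mulmxBl -[u *m _ *m C]mulmxA [(X u - x1) *m C]rowE2 -/al -/be.
  rewrite -[z1 *m x *m C]mulmxA xC.
  congr (_ \in V).
  by apply/matrixP => i j; rewrite !(mul_col_rowE, mxE); ring.
have [|V' [VV' dimV'] [m1 m2 m3]] := three_terms_span uV.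
  case: (eqVneq al 0) => [->|_]; last by rewrite orbT.
  case: (eqVneq be 0) => [->|_]; last by rewrite !orbT.
  rewrite !orbF.
  by rewrite addr0 sub0r oppr_eq0 oner_eq0.
have scaleV' (z c : 'cV_n) (y : 'rV_n) (e : 'rV_(1 + 1)) :
    z *m e \in V' -> z *m (y *m c) *m e \in V'.
  by move=> h; rewrite [y *m c]mx11_scalar mul_mx_scalar -scalemxAl memvZ.
have {}V12 (z : 'cV_n) : y1 *m z = 0 -> y2 *m z = 0 -> z *m e1 \in V'.
  by move=> a b; apply: (subvP VV'); apply: V12.
have {}V13 (z : 'cV_n) : y1 *m z = 0 -> y3 *m z = 0 -> z *m e2 \in V'.
  by move=> a b; apply: (subvP VV'); apply: V13.
have z1e2 : z1 *m e2 \in V'.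
  by rewrite -[e2](subrK e1) mulmxDr memvD // (subvP VV') ?V23.
(* Each of the two columns splits along [z1], [z2], [z3] and the common kernel of the three rows;
   every resulting term is already known to lie in [V']. *)
have V'T : V' = fullv.
  apply/eqP; rewrite eqEsubv subvf; apply/subvP => m _.
  have -> : m = lsubmx (m : 'M_(n, 1 + 1)) *m e1 + rsubmx (m : 'M_(n, 1 + 1)) *m e2.
    by rewrite /e1 /e2 !mul_mx_row !mulmx1 !mulmx0 add_row_mx add0r addr0 hsubmxK.
  have rest (c : 'cV_n) : exists2 w : 'cV_n,
      [/\ y1 *m w = 0, y2 *m w = 0 & y3 *m w = 0] &
      c = z1 *m (y1 *m c) + z2 *m (y2 *m c) + z3 *m (y3 *m c) + w.
    exists (c - (z1 *m (y1 *m c) + z2 *m (y2 *m c) + z3 *m (y3 *m c)));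
      last by rewrite addrC subrK.
    split; rewrite mulmxBr !mulmxDr !mulmxA.
    - by rewrite y1z1 y1z2 y1z3 !mul0mx !mul1mx !addr0 subrr.
    - by rewrite y2z1 y2z2 y2z3 !mul0mx !mul1mx add0r !addr0 subrr.
    - by rewrite y3z1 y3z2 y3z3 !mul0mx !mul1mx !add0r subrr.
  apply: memvD.
    have [w [y1w y2w y3w] ->] := rest (lsubmx (m : 'M_(n, 1 + 1))).
    by rewrite !mulmxDl; do !apply: memvD; do ?apply: scaleV' => //; apply: V12.
  have [w [y1w y2w y3w] ->] := rest (rsubmx (m : 'M_(n, 1 + 1))).
  by rewrite !mulmxDl; do !apply: memvD; do ?apply: scaleV' => //; apply: V13.
move: dimV'; rewrite V'T dimvf /dim /=; lia.
Qed.

(** * Restriction to a hyperplane, the base case and the induction *)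

(** The columns of [E^T] form a basis of the kernel of [y], which identifies it with [K^n]; pulling
    [T] back along [E^T] yields a copy of its matrices killed by [y]. *)
Lemma const_mod_on_of_dim (K : fieldType) (n p d : nat) (T : {vspace 'M[K]_(n.+1, p)})
  (X : 'cV[K]_n.+1 -> 'rV[K]_p) (y : 'rV[K]_n.+1) :
  (forall (T' : {vspace 'M[K]_(n, p)}) X', linear_mod T' X' ->
    (\dim T' <= d)%N -> const_mod T' X') ->
  linear_mod T X -> y != 0 -> (\dim (T :&: lker (linfun (mulmx y))) <= d)%N ->
  exists x, const_mod_on T X y x.
Proof.
move=> IH lin y0 dimT.
have [E Efree yE] : exists2 E : 'M[K]_(n, n.+1), row_free E & (E :=: kermx y^T)%MS.
  have : \rank (kermx y^T) = n by rewrite mxrank_ker mxrank_tr rank_rV y0 subn1.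
  have := row_base_free (kermx y^T); have := eq_row_base (kermx y^T).
  move: (row_base _) => B hB fB e; move: B hB fB; rewrite e => B hB fB.
  by exists B.
have yET : y *m E^T = 0.
  apply: trmx_inj; rewrite trmx_mul trmxK trmx0; apply/eqP.
  by rewrite -[_ == _]/(_ == _) -sub_kermx yE.
have Einj (m : 'M[K]_(n, p)) : E^T *m m = 0 -> m = 0.
  move=> h; apply: trmx_inj; rewrite trmx0; apply/eqP.
  by rewrite -(mulmx_free_eq0 _ Efree) -[E]trmxK -trmx_mul h trmx0.
pose f := linfun (mulmx E^T : 'M[K]_(n, p) -> 'M[K]_(n.+1, p)).
have fE m : f m = E^T *m m by rewrite lfunE.
have [||x hx] := IH (f @^-1: T)%VS (fun z => X (E^T *m z)).
- move=> a z w; rewrite -memv_preim fE mulmxBr [X in _ - X]mulmxDr -scalemxAr !mulmxA.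
  rewrite mulmxDr -scalemxAr.
  exact: lin.
- apply: leq_trans dimT; rewrite -(limg_dim_eq (f := f)); last first.
    apply/eqP; rewrite -subv0; apply/subvP => m /memv_capP[_].
    by rewrite memv_ker fE memv0 => /eqP/Einj->.
  apply/dimvS/subvP => _ /memv_imgP[m hm ->]; rewrite memv_cap memv_ker fE lfunE /=.
  by rewrite mulmxA yET mul0mx eqxx andbT -fE memv_preim.
exists x => z yz.
have /submxP[D hD] : (z^T <= E)%MS.
  by rewrite yE; apply/sub_kermxP; rewrite -trmx_mul yz trmx0.
have -> : z = E^T *m D^T by rewrite -trmx_mul -hD trmxK.
by have := hx D^T; rewrite -memv_preim fE mulmxA.
Qed.

Lemma dim_gt1_row_free (K : fieldType) (p : nat) (U : {vspace 'rV[K]_p}) (a b : 'rV[K]_p) :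
  a \in U -> b \in U -> row_free (col_mx a b) -> (1 < \dim U)%N.
Proof.
move=> aU bU free_ab; rewrite ltnNge; apply/negP => dimU.
have [a0|a0] := eqVneq a 0.
  move: free_ab; rewrite a0 /row_free rank_col_0mx => /eqP e.
  by have := rank_leq_row b; rewrite e.
have /eqP e : <[a]>%VS == U by rewrite eqEdim -memvE aU dim_vline a0.
move: bU; rewrite -e => /vlineP[s bs]; move: free_ab.
have -> : col_mx a b = col_mx 1%:M s%:M *m a.
  by rewrite mul_col_mx mul1mx mul_scalar_mx bs.
move=> /eqP e1; have := leq_trans (mxrankM_maxr (col_mx 1%:M s%:M) a) (rank_leq_row a).
by rewrite e1.
Qed.

Lemma line_of_dim1 (K : fieldType) (vT : vectType K) (U : {vspace vT}) :
  (\dim U <= 1)%N -> exists m, U = <[m]>%VS.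
Proof.
have [->|U0] := eqVneq U 0%VS.
  by exists 0; apply/esym/eqP; rewrite -dimv_eq0 dim_vline eqxx.
move=> dimU; exists (vpick U); apply/esym/eqP.
by rewrite eqEdim -memvE memv_pick dim_vline vpick0 U0.
Qed.

Lemma const_mod_two_rows (K : fieldType) (p : nat) (T : {vspace 'M[K]_(2, p)})
  (X : 'cV[K]_2 -> 'rV[K]_p) :
  linear_mod T X -> (\dim T <= 1)%N -> (\dim T = 0%N \/ more_than_two_elements K) ->
  const_mod T X.
Proof.
move=> lin dimT dimT_K.
have [m Tm] := line_of_dim1 dimT.
have [[x mx]|no_x] := classic (exists x : 'rV_p, (m <= x)%MS).
  apply: (const_mod_rank1 (x := x) lin) => k.
  by rewrite Tm => /vlineP[s ->]; rewrite scalemx_sub.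
have m0 : m != 0 by apply/eqP => m0; apply: no_x; exists 0; rewrite m0 sub0mx.
have {dimT_K} [th [th0 th1]] : more_than_two_elements K.
  by case: dimT_K => // /eqP; rewrite Tm dim_vline m0.
have rows_sub (x : 'rV_p) : (row 0 m <= x)%MS -> (row 1 m <= x)%MS -> False.
  move=> h0 h1; apply: no_x; exists x; apply/row_subP => i.
  case: (eqVneq i 0) => [->//|i0].
  by have -> : i = 1 by apply/val_inj; case: i i0 => [[|[|]]].
have r0 : row 0 m != 0.
  by apply/eqP => e; apply: (rows_sub (row 1 m)) => //; rewrite e sub0mx.
have r1 : ~~ (row 1 m <= row 0 m)%MS by apply/negP => /rows_sub; apply.
pose z1 : 'cV[K]_2 := delta_mx 0 0; pose z2 : 'cV[K]_2 := delta_mx 1 0.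
(* The linearity defect of [a *: z1 + z2] is [k *: m]; row 0 minus [a] times row 1 eliminates
   [X (a *: z1 + z2)]. *)
have key a : exists k, a *: (X z2 - X z1) = k *: row 0 m - (a * k) *: row 1 m.
  have := lin a z1 z2; rewrite Tm => /vlineP[k /matrixP e]; exists k.
  apply/rowP => j; have := e 0 j; have := e 1 j.
  by rewrite !(mul_col_rowE, mxE) /= -mulrA => <- <-; ring.
have [k1 e1] := key 1; have [k2 e2] := key th.
(* Comparing [a = 1] with [a = th] gives [th * k1 = k2] and [k1 = k2], so [k2 = 0] as [th] is not
   1. *)
have k20 : k2 = 0.
  have e : (th * k1 - k2) *: row 0 m = (th * (k1 - k2)) *: row 1 m.
    move: e1; rewrite scale1r => e1; rewrite e1 mul1r in e2.
    apply/rowP => j; move/rowP/(_ j): e2; rewrite !mxE => e2.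
    apply/eqP; rewrite -subr_eq0; apply/eqP.
    move/eqP: e2; rewrite -subr_eq0 => /eqP <-; ring.
  have e3 := scale_eq_indep r1 e.
  move: e; rewrite e3 scale0r => /eqP;
  rewrite scaler_eq0 (negPf r0) orbF subr_eq0 => /eqP e4.
  move/eqP: e3; rewrite mulf_eq0 (negPf th0) subr_eq0 /= => /eqP k12.
  apply/eqP; move/eqP: e4; rewrite k12 -subr_eq0 -{2}[k2]mul1r -mulrBl mulf_eq0 subr_eq0.
  by rewrite (negPf th1).
have X12 : X z2 = X z1.
  move/eqP: e2; rewrite k20 mulr0 !scale0r subrr scaler_eq0 (negPf th0) subr_eq0.
  by move/eqP.
exists (X z1) => z.
have -> : z = z 0 0 *: z1 + (z 1 0 *: z2 + 0).
  apply/colP => i; rewrite !mxE.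
  case: (eqVneq i 0) => [->|i0]; first by rewrite /=; ring.
  by have -> : i = 1 by [apply/val_inj; case: i i0 => [[|[|]]]]; rewrite /=; ring.
apply: const_mod_comb => //; first by rewrite subrr mulmx0 mem0v.
by apply: const_mod_comb => //; rewrite ?X12 ?subrr ?mulmx0 ?mul0mx mem0v.
Qed.

(** The constant [c] treats both cases of [d_n] at once: with two rows it leaves [dim T = 0] for
    [c = 4] and [dim T <= 1] for [c = 3], as [const_mod_two_rows] requires. *)
Lemma const_mod_of_dim (K : fieldType) (n p c : nat) (T : {vspace 'M[K]_(n.+2, p)})
  (X : 'cV[K]_n.+2 -> 'rV[K]_p) :
  c = 4%N \/ c = 3%N /\ more_than_two_elements K ->
  linear_mod T X -> (\dim T + c <= 2 * n.+2)%N -> const_mod T X.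
Proof.
move=> hc; elim: n => [|n IHn] in T X *.
  move=> lin dimT; apply: const_mod_two_rows => //; first by lia.
  by case: hc => [?|[_ ?]]; [left; lia | right].
move=> lin dimT; have c34 : (3 <= c <= 4)%N by case: hc => [->|[->]].
have [[x Tx]|no_x] := classic (exists x : 'rV_p, forall m, m \in T -> (m <= x)%MS).
  exact: const_mod_rank1 lin Tx.
have big (x : 'rV_p) : exists2 m : 'M_(n.+3, p), m \in T & ~~ (m <= x)%MS.
  apply: NNPP => h; apply: no_x; exists x => m mT; apply/negPn/negP => mx.
  by apply: h; exists m.
have good (y : 'rV_n.+3) : y != 0 ->
    (\dim (T :&: lker (linfun (mulmx y))) + c <= 2 * n.+2)%N ->
    exists x, const_mod_on T X y x.
  move=> y0 dimTy; apply: (const_mod_on_of_dim (d := 2 * n.+2 - c)) => //; last first.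
    by have := leq_sub2r c dimTy; rewrite addnK.
  by move=> T' X' lin' dimT'; apply: IHn => //; lia.
have good2 (y : 'rV_n.+3) (m m' : 'M_(n.+3, p)) : m \in T -> m' \in T ->
    row_free (col_mx (y *m m) (y *m m')) -> exists x, const_mod_on T X y x.
  move=> mT m'T free_y; apply: good.
    apply: contraTneq free_y => ->; rewrite !mul0mx /row_free rank_col_0mx mxrank0 //.
  have : (1 < \dim (linfun (mulmx y) @: T))%N.
    apply: dim_gt1_row_free free_y.
      by have := memv_img (linfun (mulmx y)) mT; rewrite lfunE.
    by have := memv_img (linfun (mulmx y)) m'T; rewrite lfunE.
  move: dimT; rewrite -(limg_ker_dim (linfun (mulmx y)) T).
  move: (\dim (_ :&: _)) (\dim (_ @: _)) => a b; lia.
have good1 (y : 'rV_n.+3) (m : 'M_(n.+3, p)) : m \in T -> (T <= <[m]>)%VS ->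
    y *m m != 0 -> exists x, const_mod_on T X y x.
  move=> mT Tm ym; apply: good; first by apply: contraNneq ym => ->; rewrite mul0mx.
  have -> : (T :&: lker (linfun (mulmx y)) = 0)%VS.
    apply/eqP; rewrite -subv0; apply/subvP => k /memv_capP[/(subvP Tm)/vlineP[s ->]].
    rewrite memv_ker lfunE /= -scalemxAr scaler_eq0 (negPf ym) orbF => /eqP->.
    by rewrite scale0r mem0v.
  (* The bound for the zero space is [c <= 2 * n.+2], true since [c <= 4]. *)
  by rewrite dimv0; lia.
have n3 : (2 < n.+3)%N by [].
have [y1 [y2 [y10 y2y1 [x1 h1] [x2 h2]]]] := two_good n3 good2 good1 big.
have [x21|x21] := eqVneq x2 x1.
  by rewrite x21 in h2; exact: const_mod_glue lin y2y1 h1 h2.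
have [y3 [x3 [y3y h3]]] := third_good n3 good2 big h1 h2 x21.
apply: (const_mod_of_three lin _ y10 y2y1 y3y h1 h2 h3); lia.
Qed.

(** * Duality and the theorem *)

(* For [m = z *m v] the pairing [mxvec m *m (mxvec M)^T] is [z^T *m M *m v^T],
   by [mxvec_dotmul]. *)
Lemma exists_orthogonal (K : fieldType) (n p : nat) (S : {vspace 'M[K]_(n, p)}) :
  exists2 T : {vspace 'M[K]_(n, p)}, (\dim T + \dim S = n * p)%N &
    forall m, (m \in T) <-> (forall M, M \in S -> mxvec m *m (mxvec M)^T = 0).
Proof.
pose b := vbasis S; pose B := \matrix_(i < \dim S) mxvec b`_i.
pose f := linfun (mulmxr B^T \o mxvec : 'M[K]_(n, p) -> 'rV[K]_(\dim S)).
have fE m : f m = mxvec m *m B^T by rewrite lfunE.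
have Bfree : row_free B.
  apply: inj_row_free => v; rewrite mulmx_sum_row => h.
  have /freeP free_b := basis_free (vbasisP S).
  apply/rowP => i; rewrite mxE; apply: (free_b (fun i => v 0 i)).
  apply: (can_inj mxvecK); rewrite linear0 -[RHS]h linear_sum; apply: eq_bigr => k _.
  by rewrite rowK linearZ.
exists (lker f).
  have := limg_ker_dim f fullv; rewrite capfv.
  have -> : (f @: fullv = fullv)%VS.
    apply/eqP; rewrite eqEsubv subvf; apply/subvP => v _.
    have [D hD] := row_freeP Bfree.
    apply/memv_imgP; exists (vec_mx (v *m D^T)); first exact: memvf.
    by rewrite fE vec_mxK -mulmxA -trmx_mul hD trmx1 mulmx1.
  by rewrite !dimvf /dim /= mul1n.
move=> m; rewrite memv_ker fE; split=> [/eqP h M MS|h].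
  rewrite (coord_vbasis MS) linear_sum linear_sum mulmx_sumr big1 // => i _.
  rewrite !linearZ /= -[mxvec b`_i](rowK (fun i => mxvec b`_i)) tr_row.
  by rewrite colE mulmxA h mul0mx scaler0.
apply/eqP/trmx_inj; rewrite trmx_mul trmxK trmx0; apply/row_matrixP => i.
rewrite row_mul rowK row0; apply: trmx_inj; rewrite trmx_mul trmxK trmx0 h //.
by rewrite vbasis_mem // mem_nth // size_tuple.
Qed.

(** Factors [M |-> z^T *m F M] through [M |-> z^T *m M] using a generalized inverse of the latter;
    range-compatibility makes this an actual factorization. *)
Definition functional_row (K : fieldType) (n p : nat) (S : {vspace 'M[K]_(n, p)})
  (F : {linear subvs_of S -> 'cV[K]_n}) (z : 'cV[K]_n) : 'rV[K]_p :=
  let g := linfun (mulmx z^T \o vsval : subvs_of S -> 'rV[K]_p) in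
  let h := linfun (mulmx z^T \o F : subvs_of S -> 'rV[K]_1) in
  (lin1_mx (h \o g^-1)%VF)^T.

Lemma functional_rowP (K : fieldType) (n p : nat) (S : {vspace 'M[K]_(n, p)})
  (F : {linear subvs_of S -> 'cV[K]_n}) (z : 'cV[K]_n) (M : subvs_of S) :
  range_compatible F -> z^T *m F M = z^T *m vsval M *m (functional_row F z)^T.
Proof.
move=> rc; rewrite /functional_row trmxK mul_rV_lin1.
set h := linfun (mulmx z^T \o F); set g := linfun (mulmx z^T \o vsval).
have gE N : g N = z^T *m vsval N by rewrite lfunE.
have hE N : h N = z^T *m F N by rewrite lfunE.
rewrite -gE -hE /= comp_lfunE; apply/eqP; rewrite -subr_eq0 -linearB /=; apply/eqP.
(* [N] is the error of the generalized inverse: [z^T] kills [N], hence also [F N], which has the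
   form [N *m Y]. *)
set N := M - _; have gN : g N = 0.
  by rewrite linearB /= limg_lfunVK ?subrr // memv_img ?memvf.
by rewrite hE; have [Y ->] := rc N; rewrite mulmxA -gE gN mul0mx.
Qed.

Unset Implicit Arguments.

Theorem theorem1p2 (K : fieldType) (n p : nat) (hn : (1 <= n)%N) (hp : (2 <= p)%N)
  (S : {vspace 'M[K]_(n, p)}) (hcodim : codim S <= d_n K n)
  (F : {linear subvs_of S -> 'cV[K]_n}) :
  range_compatible F -> local F.
Proof.
move=> rc; have [T dimT TP] := exists_orthogonal S.
have [c hc dimTc] : exists2 c, c = 4%N \/ c = 3%N /\ more_than_two_elements K
    & (\dim T + c <= 2 * n)%N.
  move: hcodim; rewrite /codim /d_n dimvf /dim /= -dimT.
  move: (\dim T : nat) (\dim S : nat) => t s.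
  case: excluded_middle_informative => [K2|K2] /= h.
    by exists 3%N; [right | lia].
  by exists 4%N; [left | lia].
(* A single row is impossible: [dim T + c <= 2] contradicts [c >= 3]. *)
case: n => [|[|n]] in S F hn hcodim rc T dimT TP dimTc *; [lia| |].
  by case: hc => [|[]]; lia.
pose X := functional_row F.
have XP z (M : subvs_of S) : z^T *m vsval M *m (X z)^T = z^T *m F M.
  by rewrite functional_rowP.
have pairing (z : 'cV[K]_n.+2) (v : 'rV[K]_p) (M : 'M[K]_(n.+2, p)) :
    mxvec (z *m v) *m (mxvec M)^T = z^T *m M *m v^T.
  by have := mxvec_dotmul M z^T v; rewrite trmxK.
have lin : linear_mod T X.
  (* Paired with [M], [z *m X z] gives [z^T *m F M], which is linear in [z]. *)
  move=> a z w; apply/TP => M MS; rewrite -(vsprojK MS).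
  rewrite linearB linearD linearZ /=.
  rewrite mulmxBl [X in _ - X]mulmxDl -scalemxAl !pairing !XP.
  by rewrite linearD linearZ /= mulmxDl -scalemxAl subrr.
have [x hx] := const_mod_of_dim hc lin dimTc.
exists x^T => M; apply/row_matrixP => i.
rewrite !rowE -[delta_mx 0 i]trmxK -XP; apply/eqP.
rewrite mulmxA -subr_eq0 -mulmxBr -linearB.
rewrite -pairing; apply/eqP.
exact: (proj1 (TP _) (hx _) _ (subvsP M)).
Qed.
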